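(* Let $G$ be a $k$-regular bipartite graph of order $m$ with $k\geq 2$, and let $H$ be a $2t$-regular graph of order $n$ that admits a neighborhood balanced coloring and that admits a local distance antimagic labeling. Then $\chi_{ld}(G[H])\leq 2\,\chi_{ld}(H)$.
   Context: All graphs are finite, simple, undirected and without isolated vertices. For a graph $G$ of order $n$ and a bijection $f\colon V(G)\to\{1,2,\dots,n\}$, the weight of a vertex $u$ is $w_f(u)=\sum_{x\in N(u)}f(x)$, where $N(u)$ is the open neighborhood of $u$. The bijection $f$ is a local distance antimagic labeling of $G$ if $w_f(u)\neq w_f(v)$ for every edge $uv$ of $G$. The local distance antimagic chromatic number $\chi_{ld}(G)$ is the minimum number of distinct weights over all local distance antimagic labelings of $G$ (an upper bound on $\chi_{ld}$ includes the assertion that such a labeling exists). A neighborhood balanced coloring of a graph is an assignment of one of two colors to each vertex (not necessarily proper) such that every vertex has equally many neighbors of each color. The lexicographic product (composition) $G[H]$ has vertex set $V(G)\times V(H)$, with $(g,h)$ and $(g',h')$ adjacent iff either $gg'\in E(G)$, or $g=g'$ and $hh'\in E(H)$. *)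

(* Defs.v *)
From mathcomp Require Import all_boot.

Set Implicit Arguments.
Unset Strict Implicit.
Unset Printing Implicit Defensive.

Record sgraph := SGraph {
  vertex :> finType;
  adj : rel vertex;
  adj_sym : symmetric adj;
  adj_irrefl : irreflexive adj
}.

Arguments adj {s}.

Definition nbhd (G : sgraph) (u : G) : {set G} := [set x | adj u x].

Definition no_isolated (G : sgraph) : Prop := forall u : G, nbhd u != set0.

Definition regular (G : sgraph) (k : nat) : Prop := forall u : G, #|nbhd u| = k.

Definition bipartite (G : sgraph) : Prop :=
  exists A : {set G}, forall x y : G, adj x y -> (x \in A) != (y \in A).

Definition balanced_coloring (G : sgraph) (c : G -> bool) : Prop :=
  forall u : G, #|[set x in nbhd u | c x]| = #|[set x in nbhd u | ~~ c x]|.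

Definition has_balanced_coloring (G : sgraph) : Prop :=
  exists c : G -> bool, balanced_coloring c.

(* A vertex labeling with values in {1, ..., #|G|} is encoded by an 'I_#|G|   *)
(* valued function; the actual label of x is (f x).+1.                        *)
Definition labeling (G : sgraph) := {ffun G -> 'I_#|G|}.

Definition label (G : sgraph) (f : labeling G) (x : G) : nat := (f x).+1.

Definition weight (G : sgraph) (f : labeling G) (u : G) : nat :=
  \sum_(x in nbhd u) label f x.

Definition bijective_labeling (G : sgraph) (f : labeling G) : bool :=
  injectiveb f && [forall i, i \in codom f].

Definition ld_labeling (G : sgraph) (f : labeling G) : bool :=
  bijective_labeling f &&
  [forall u : G, forall v : G, adj u v ==> (weight f u != weight f v)].

Definition num_weights (G : sgraph) (f : labeling G) : nat :=
  size (undup (codom (weight f))).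

Definition ld_labelable (G : sgraph) : Prop :=
  exists f : labeling G, ld_labeling f.

(* Every labeling has at most #|G| weights, so the default value #|G| does    *)
(* not affect the minimum; it is a junk value when G is not ld_labelable.     *)
Definition chi_ld (G : sgraph) : nat :=
  \big[minn/#|G|]_(f : labeling G | ld_labeling f) num_weights f.

Lemma num_weights_le (G : sgraph) (f : labeling G) : num_weights f <= #|G|.
Proof. by rewrite /num_weights (leq_trans (size_undup _)) ?size_codom. Qed.

Lemma chi_ld_le (G : sgraph) (f : labeling G) :
  ld_labeling f -> chi_ld G <= num_weights f.
Proof.
rewrite /chi_ld => Hf.
have: f \in index_enum (labeling G) by rewrite mem_index_enum.
elim: (index_enum _) => //= g s IH; rewrite inE big_cons.
case/orP => [/eqP <-|fs]; first by rewrite Hf geq_minl.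
by case: ifP => _; rewrite ?geq_min ?IH ?orbT.
Qed.

Lemma chi_ld_attained (G : sgraph) : ld_labelable G ->
  exists2 f : labeling G, ld_labeling f & num_weights f = chi_ld G.
Proof.
case=> f0 Hf0.
have [E|[f Hf Ef]] : chi_ld G = #|G| \/
    exists2 f : labeling G, ld_labeling f & num_weights f = chi_ld G.
- rewrite /chi_ld; elim: (index_enum _) => [|g s IH].
    by left; rewrite big_nil.
  rewrite big_cons; case: ifP => // Hg; right.
  case: (leqP (num_weights g)) => [_|lt]; first by exists g.
  by case: IH => [E|//]; move: lt; rewrite E ltnNge num_weights_le.
- by exists f0 => //; apply/eqP; rewrite eqn_leq chi_ld_le // andbT E num_weights_le.
- by exists f.
Qed.

Section LexProduct.
Variables G H : sgraph.

Definition lex_adj (p q : G * H) : bool :=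
  adj p.1 q.1 || (p.1 == q.1) && adj p.2 q.2.

Lemma lex_adj_sym : symmetric lex_adj.
Proof. by move=> p q; rewrite /lex_adj adj_sym eq_sym (adj_sym p.2). Qed.

Lemma lex_adj_irrefl : irreflexive lex_adj.
Proof. by move=> p; rewrite /lex_adj !adj_irrefl andbF. Qed.

Definition lex_product : sgraph := SGraph lex_adj_sym lex_adj_irrefl.
End LexProduct.

(* Main.v *)
(** Let [A] and [B] be the two sides of [G]; both have [p = m / 2] vertices.
  Fix an optimal labeling [f] of [H] and a balanced coloring of [H], and number
  the vertices of each side by [i = 0, ..., p - 1].  Label [(g, h)] by
  [p (f h - 1) + i + 1] or [p (f h - 1) + p - i] according to the color of [h],
  shifting the labels over [B] by [p n].  Since both colors are equally frequent
  in [H] and in every neighborhood of [H], the terms in [i] cancel, so the weight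
  of [(g, h)] is determined by the side of [g] and the weight of [h].  Inside
  a copy of [H] this dependence is injective.  Between the two sides, the [k]
  neighboring copies contribute [k p n^2] more to a vertex over [A], whereas the
  terms from [H] differ by less than [2 p n^2]; this is where [k >= 2] enters. *)

From mathcomp Require Import all_boot.
From mathcomp Require Import zify.
Require Import Defs.

Set Implicit Arguments.
Unset Strict Implicit.
Unset Printing Implicit Defensive.

Lemma labeling_of_inj (G : sgraph) (L : G -> nat) :
    injective L -> (forall x, L x < #|G|) ->
  exists2 f : labeling G, bijective_labeling f & forall x, label f x = (L x).+1.
Proof.
move=> L_inj L_lt.
pose f : labeling G := [ffun x => Ordinal (L_lt x)].
have f_inj : injective f.
  by move=> x y; rewrite !ffunE => /(congr1 val) /L_inj.
exists f; last by move=> x; rewrite /label ffunE.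
apply/andP; split; first exact/injectiveP.
have [g fK gK] : bijective f by apply: inj_card_bij; rewrite ?card_ord.
by apply/forallP => i; apply/codomP; exists (g i); rewrite gK.
Qed.

(** Double counting: each [F x] is collected once by each of the [k] neighbors of [x]. *)
Lemma sum_regular (G : sgraph) k (F : G -> nat) : regular G k ->
  \sum_u \sum_(x in nbhd u) F x = k * \sum_x F x.
Proof.
move=> G_reg.
rewrite (exchange_big_dep predT) //= big_distrr /=; apply: eq_bigr => x _.
rewrite sum_nat_const -(G_reg x); congr muln.
apply: eq_card => u; rewrite [RHS]inE adj_sym; exact: (in_set (adj u)).
Qed.

Lemma sum_mem (T : finType) (A : {set T}) : \sum_x (x \in A : nat) = #|A|.
Proof. by rewrite -sum1_card [RHS]big_mkcond; apply: eq_bigr => x _; case: (x \in A). Qed.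

(** A vertex has all [k] of its neighbors in [A] or none, according as it lies outside or inside
    [A]; counting the edges from both ends gives [k] times either side. *)
Lemma regular_bipartition_card (G : sgraph) k (A : {set G}) :
    0 < k -> regular G k ->
    (forall x y, adj x y -> (x \in A) != (y \in A)) ->
  #|~: A| = #|A|.
Proof.
move=> k_gt0 G_reg A_bip; apply/eqP; rewrite -(eqn_pmul2l k_gt0); apply/eqP.
rewrite -!sum_mem -[RHS](sum_regular _ G_reg) mulnC big_distrl /=; apply: eq_bigr => u _.
rewrite inE -(G_reg u) mulnC -sum_nat_const; apply: eq_bigr => x.
by rewrite inE => /A_bip; case: (u \in A); case: (x \in A).
Qed.

Section Balanced.

Variables (H : sgraph) (t : nat) (c : H -> bool).
Hypotheses (H_reg : regular H (2 * t)) (c_bal : balanced_coloring c).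

Lemma sum_nbhd_balanced a b (u : H) :
  \sum_(x in nbhd u) (if c x then a else b) = t * (a + b).
Proof.
have card_split : #|[set x in nbhd u | c x]| + #|[set x in nbhd u | ~~ c x]| = 2 * t.
  rewrite -(H_reg u) -(cardsID [set x | c x] (nbhd u)).
  by congr (_ + _); apply: eq_card => x; rewrite !inE // andbC.
rewrite (bigID c) /=.
rewrite (eq_bigr (fun=> a)) => [|x /andP[_ ->] //].
rewrite [X in _ + X](eq_bigr (fun=> b)) => [|x /andP[_ /negbTE ->] //].
rewrite !sum_nat_cond_const.
have := c_bal u; move: card_split.
set r := #|_|; set s := #|_|; nia.
Qed.

(** Summing [sum_nbhd_balanced] over all vertices counts each term [2 * t] times; then [t]
    cancels. *)
Lemma sum_balanced a b : no_isolated H ->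
  2 * \sum_x (if c x then a else b) = #|H| * (a + b).
Proof.
(* Positivity of [t] needs a vertex, so the empty graph is treated apart. *)
move=> H_noiso; have [H0|/card_gt0P[u _]] := posnP #|H|.
  by rewrite H0 big1 // => x; have := fintype0 x H0.
have t_gt0 : 0 < t.
  by have := H_noiso u; rewrite -card_gt0 H_reg; case: (t).
have := sum_regular (fun x => if c x then a else b) H_reg.
rewrite (eq_bigr (fun=> t * (a + b))) => [|v _]; last exact: sum_nbhd_balanced.
rewrite sum_nat_const => E; apply/eqP; rewrite -(eqn_pmul2l t_gt0) mulnCA mulnA -E.
by rewrite mulnCA.
Qed.

End Balanced.

Lemma lex_weight (G H : sgraph) (F : labeling (lex_product G H)) g h :
  weight F (g, h) =
  \sum_(g' in nbhd g) \sum_h' label F (g', h') + \sum_(h' in nbhd h) label F (g, h').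
Proof.
rewrite /weight (bigID (fun q : G * H => adj g q.1)) /=; congr (_ + _).
  rewrite pair_big /=; apply: eq_big => [[g' h']|[] //].
  by rewrite !inE andbT /= /lex_adj /=; case: (adj g g'); rewrite ?andbF.
rewrite (@reindex_onto _ _ _ (G * H)%type H (pair g) snd) /=.
  by apply: eq_bigl => h'; rewrite !inE /= /lex_adj /= adj_irrefl !eqxx !andbT.
case=> g' h'; rewrite inE /= /lex_adj /=; case: (adj g g') => //=.
by rewrite andbT => /andP[/eqP ->].
Qed.

Section LexLabeling.

Variables (G H : sgraph) (k t : nat) (A : {set G}) (c : H -> bool) (f : labeling H).
Hypotheses (k_ge2 : 2 <= k) (G_reg : regular G k).
Hypothesis A_bip : forall x y : G, adj x y -> (x \in A) != (y \in A).

Let p := #|A|.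
Let n := #|H|.

Definition side_index (g : G) : nat :=
  if g \in A then index g (enum A) else index g (enum (~: A)).

Definition lex_rank (g : G) (h : H) : nat :=
  if c h then side_index g else p.-1 - side_index g.

Definition lex_label (q : G * H) : nat :=
  (q.1 \notin A) * (p * n) + p * f q.2 + lex_rank q.1 q.2.

Let card_compl : #|~: A| = p.
Proof. exact: regular_bipartition_card (ltnW k_ge2) G_reg A_bip. Qed.

Lemma side_index_lt g : side_index g < p.
Proof.
rewrite /side_index; case: ifP => gA; first by rewrite /p cardE index_mem mem_enum.
by rewrite -card_compl cardE index_mem mem_enum inE gA.
Qed.

Lemma side_index_inj g g' :
  (g \in A) = (g' \in A) -> side_index g = side_index g' -> g = g'.
Proof.
rewrite /side_index => sideE; rewrite -sideE.
by case: ifP => gA /(index_inj g); rewrite !mem_enum ?inE -sideE gA; apply.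
Qed.

Lemma lex_rank_lt g h : lex_rank g h < p.
Proof. by have := side_index_lt g; rewrite /lex_rank; case: ifP; lia. Qed.

Lemma lex_label_lt q : lex_label q < #|lex_product G H|.
Proof.
have -> : #|lex_product G H| = (p + p) * n.
  by rewrite card_prod -(cardsC A) card_compl.
have := lex_rank_lt q.1 q.2; have : f q.2 < n := ltn_ord _.
rewrite /lex_label; case: (_ \notin _); nia.
Qed.

(** A label is a mixed-radix numeral with digits side, [f h] and rank; Euclidean division by [p] and
    then by [n] recovers them. *)
Lemma lex_label_inj : injective f -> injective lex_label.
Proof.
move=> f_inj [g h] [g' h']; rewrite /lex_label /= => E.
have r_lt := lex_rank_lt g h; have r'_lt := lex_rank_lt g' h'.
have p_gt0 : 0 < p by apply: leq_ltn_trans r_lt.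
have f_lt : f h < n := ltn_ord _; have f'_lt : f h' < n := ltn_ord _.
have [Ef Er] : (g \notin A) * n + f h = (g' \notin A) * n + f h'
    /\ lex_rank g h = lex_rank g' h'.
  have /(congr1 (edivn^~ p)) : ((g \notin A) * n + f h) * p + lex_rank g h
      = ((g' \notin A) * n + f h') * p + lex_rank g' h'.
    by move: E; case: (g \in A); case: (g' \in A) => /=; lia.
  by rewrite /= !edivn_eq // => -[].
have [sideE fE] : (g \in A) = (g' \in A) /\ (f h = f h' :> nat).
  move/(congr1 (edivn^~ n)): Ef; rewrite /= !edivn_eq // => -[].
  by case: (g \in A); case: (g' \in A).
have hE : h = h' by apply/f_inj/val_inj.
congr (_, _) => //; apply: side_index_inj => //.
(* Both ranks now use the color of the same vertex, hence the same direction of numbering. *)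
move: Er; rewrite /lex_rank hE.
by have := side_index_lt g; have := side_index_lt g'; case: ifP => _; lia.
Qed.

Hypotheses (H_noiso : no_isolated H) (H_reg : regular H (2 * t)).
Hypothesis c_bal : balanced_coloring c.

Lemma lex_rank_nbhd_sum g h : \sum_(h' in nbhd h) lex_rank g h' = t * p.-1.
Proof.
rewrite (sum_nbhd_balanced H_reg c_bal); congr (_ * _).
by have := side_index_lt g; lia.
Qed.

(** The halving is exact: by [sum_balanced], [n * p.-1] is twice the sum. *)
Lemma lex_rank_sum g : \sum_h lex_rank g h = (n * p.-1)./2.
Proof.
have -> : p.-1 = side_index g + (p.-1 - side_index g).
  by have := side_index_lt g; lia.
by rewrite -(sum_balanced H_reg c_bal) // mul2n doubleK.
Qed.

Let nbhd_sum h := \sum_(h' in nbhd h) (f h' : nat).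
(** Total label of a copy of [H] over [A]; the last [n] restores the successors, as [lex_label]
    starts at 0. *)
Let copy_sum := p * \sum_h (f h : nat) + (n * p.-1)./2 + n.

Lemma weight_nbhd_sum h : weight f h = nbhd_sum h + 2 * t.
Proof.
rewrite /weight /label -(H_reg h) -sum1_card -big_split /=.
by apply: eq_bigr => x _; rewrite addn1.
Qed.

(** Here [s] tells whether the vertex lies over [A]; its neighboring copies are then shifted, and
    otherwise its own copy is. The subtraction does not truncate on weights of [f], by
    [weight_nbhd_sum]. *)
Definition lex_weight_of (s : bool) (w : nat) : nat :=
  k * (s * (p * n * n) + copy_sum)
  + (~~ s * (p * n * (2 * t)) + p * (w - 2 * t) + t * p.-1 + 2 * t).

Variable F : labeling (lex_product G H).
Hypothesis F_label : forall q, label F q = (lex_label q).+1.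

Lemma lex_weightE g h : weight F (g, h) = lex_weight_of (g \in A) (weight f h).
Proof.
have labelE g' h' : label F (g', h')
    = (g' \notin A) * (p * n) + p * f h' + lex_rank g' h' + 1.
  by rewrite F_label addn1.
rewrite lex_weight /lex_weight_of weight_nbhd_sum addnK; congr (_ + _).
  rewrite -(G_reg g) -sum_nat_const; apply: eq_bigr => g'.
  rewrite inE => /A_bip sideN.
  under eq_bigr do rewrite labelE.
  rewrite !big_split /= lex_rank_sum sum1_card sum_nat_const.
  rewrite /copy_sum big_distrr /= -/n.
  by move: sideN; case: (g \in A); case: (g' \in A) => //=; lia.
under eq_bigr do rewrite labelE.
rewrite !big_split /= lex_rank_nbhd_sum sum1_card sum_nat_const H_reg.
by rewrite /nbhd_sum big_distrr /=; lia.
Qed.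

Lemma lex_weight_of_lt h h' : 0 < p ->
  lex_weight_of false (weight f h) < lex_weight_of true (weight f h').
Proof.
move=> p_gt0; rewrite /lex_weight_of !weight_nbhd_sum !addnK /=.
have n_gt0 : 0 < n by apply/card_gt0P; exists h.
have t_le : 2 * t <= n by rewrite -(H_reg h) max_card.
have s_le : nbhd_sum h <= 2 * t * n.-1.
  rewrite -(H_reg h) -sum_nat_const; apply: leq_sum => x _.
  by have : f x < n := ltn_ord _; lia.
(* The left side is at most [2 * t * (2 * n - 1)], hence at most [n * (2 * n - 1)], which is below
   [2 * n * n]. *)
have gap : n * (2 * t) + nbhd_sum h < k * (n * n) by nia.
have : p * (n * (2 * t) + nbhd_sum h) < p * (k * (n * n)) by rewrite ltn_pmul2l.
by lia.
Qed.

Lemma lex_weight_neq q q' :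
  ld_labeling f -> lex_adj q q' -> weight F q != weight F q'.
Proof.
move=> f_ld.
(* A vertex is required, since [p] is 0 when [G] is empty. *)
have p_gt0 (g : G) : 0 < p by exact: leq_ltn_trans (side_index_lt g).
case: q q' => g h [g' h'] /orP[/= /A_bip|/= /andP[/eqP <- hh']]; rewrite !lex_weightE.
  have lt1 := lex_weight_of_lt h h' (p_gt0 g).
  have lt2 := lex_weight_of_lt h' h (p_gt0 g).
  by case: (g \in A); case: (g' \in A) => // _; rewrite neq_ltn ?lt1 ?lt2 ?orbT.
have /andP[_ /forallP/(_ h)/forallP/(_ h')] := f_ld; rewrite hh' /= => wN.
rewrite /lex_weight_of !weight_nbhd_sum !addnK eqn_add2l !eqn_add2r eqn_add2l.
by rewrite (eqn_pmul2l (p_gt0 g)) -(eqn_add2r (2 * t)) -!weight_nbhd_sum.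
Qed.

(** By [lex_weightE], every weight comes from a pair of a side and a weight of [f]. *)
Lemma lex_num_weights : num_weights F <= 2 * num_weights f.
Proof.
rewrite -[2]/(size [:: true; false]) /num_weights -(size_allpairs lex_weight_of).
apply: uniq_leq_size => [|w]; first exact: undup_uniq.
rewrite mem_undup => /codomP[[g h] ->]; rewrite lex_weightE.
apply: allpairs_f; first by case: (g \in A).
by rewrite mem_undup codom_f.
Qed.

End LexLabeling.

Theorem theorem6p1 (G H : sgraph) (k m t n : nat)
  (G_noiso : no_isolated G) (H_noiso : no_isolated H)
  (k_ge2 : 2 <= k) (G_reg : regular G k) (G_bip : bipartite G) (G_order : #|G| = m)
  (H_reg : regular H (2 * t)) (H_order : #|H| = n)
  (H_nbc : has_balanced_coloring H) (H_ld : ld_labelable H) :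
  ld_labelable (lex_product G H) /\ chi_ld (lex_product G H) <= 2 * chi_ld H.
Proof.
have [A A_bip] := G_bip; have [c c_bal] := H_nbc.
have [f f_ld <-] := chi_ld_attained H_ld.
have [F F_bij F_label] : exists2 F : labeling (lex_product G H),
    bijective_labeling F & forall q, label F q = (lex_label A c f q).+1.
  apply: labeling_of_inj => [|q]; last exact: lex_label_lt k_ge2 G_reg A_bip q.
  have /andP[/andP[/injectiveP f_inj _] _] := f_ld.
  exact: lex_label_inj k_ge2 G_reg A_bip f_inj.
have F_ld : ld_labeling F.
  rewrite /ld_labeling F_bij; apply/forallP => q; apply/forallP => q'; apply/implyP.
  move=> adj_qq'.
  exact: (lex_weight_neq k_ge2 G_reg A_bip H_noiso H_reg c_bal F_label f_ld adj_qq').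
split; first by exists F.
apply: leq_trans (chi_ld_le F_ld) _.
exact: (lex_num_weights k_ge2 G_reg A_bip H_noiso H_reg c_bal F_label).
Qed.
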